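(* For a system $(\mathrm D)$ of degree $n$ the following statements are equivalent: (1) the infinitely removed straight line of the projective phase plane $\mathbb{RP}(x,y)$ does not consist of trajectories of $(\mathrm D)$; (2) $W_n(x,y)=0$ for all $(x,y)\in\mathbb{R}^2$; (3) the system $(\mathrm D)$ is projectively singular; (4) the first projectively reduced system of $(\mathrm D)$ is $$\frac{d\xi}{d\tau}=\sum_{j=0}^{n-1}\theta^{n-j-1}W_j(1,\xi),\qquad \frac{d\theta}{d\tau}=-\sum_{i=0}^n\theta^{n-i}X_i(1,\xi);$$ (5) the straight line $\theta=0$ does not consist of trajectories of the first projectively reduced system of $(\mathrm D)$; (6) the second projectively reduced system of $(\mathrm D)$ is $$\frac{d\eta}{d\nu}=-\sum_{i=0}^n\eta^{n-i}Y_i(\zeta,1),\qquad \frac{d\zeta}{d\nu}=-\sum_{j=0}^{n-1}\eta^{n-j-1}W_j(\zeta,1);$$ (7) the straight line $\eta=0$ does not consist of trajectories of the second projectively reduced system of $(\mathrm D)$.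
   Context: System $(\mathrm D)$ of degree $n$: $\frac{dx}{dt}=X(x,y)=\sum_{k=0}^n X_k(x,y)$, $\frac{dy}{dt}=Y(x,y)=\sum_{k=0}^n Y_k(x,y)$, where $X_k,Y_k$ are real homogeneous polynomials of degree $k$, $X_n$ and $Y_n$ are not both identically zero, and $X,Y$ are relatively prime (no common divisors other than real numbers). Put $W_i(x,y)=xY_i(x,y)-yX_i(x,y)$, $i=0,\dots,n$. The system is projectively nonsingular if $W_n\not\equiv 0$ on $\mathbb{R}^2$, and projectively singular if $W_n\equiv0$. Reduced systems. The substitution $x=\frac1\theta$, $y=\frac{\xi}{\theta}$ turns $(\mathrm D)$ into $\frac{d\xi}{dt}=\theta^{-m}\Xi(\xi,\theta)$, $\frac{d\theta}{dt}=\theta^{-m}\Theta(\xi,\theta)$ with $m$ an integer and $\Xi,\Theta$ polynomials not both divisible by $\theta$; the first projectively reduced system is $\frac{d\xi}{d\tau}=\Xi$, $\frac{d\theta}{d\tau}=\Theta$. The substitution $x=\frac{\zeta}{\eta}$, $y=\frac1\eta$ turns $(\mathrm D)$ into $\frac{d\eta}{dt}=\eta^{-m}H(\eta,\zeta)$, $\frac{d\zeta}{dt}=\eta^{-m}Z(\eta,\zeta)$ with $H,Z$ polynomials not both divisible by $\eta$; the second projectively reduced system is $\frac{d\eta}{d\nu}=H$, $\frac{d\zeta}{d\nu}=Z$. The projective phase plane $\mathbb{RP}(x,y)$ is the plane $(x,y)$ completed by the line at infinity (''infinitely removed straight line''), covered by the charts $(x,y)$, $(\xi,\theta)=(\frac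 yx,\frac1x)$, $(\eta,\zeta)=(\frac1y,\frac xy)$; the line at infinity is $\theta=0$, respectively $\eta=0$. In these charts the trajectories are those of $(\mathrm D)$ and of the first and second projectively reduced systems. A line consists of trajectories if it is invariant: the vector field is tangent to it at each of its points (for the line at infinity, in both charts containing parts of it); e.g. $\theta=0$ consists of trajectories of the first reduced system iff $\Theta(\xi,0)\equiv0$, and $\eta=0$ of the second iff $H(0,\zeta)\equiv0$. *)

(* Defs.v *)
From mathcomp Require Import all_boot all_order all_algebra.
(* mpoly has to be imported before derive: the reverse order is rejected
   because of incompatible precedence levels. *)
From mathcomp Require Import mpoly.
From mathcomp Require Import classical_sets boolp functions reals.
From mathcomp Require Import topology normedtype derive.
From mathcomp Require Import ring zify.
Import Order.TTheory GRing.Theory Num.Theory.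
Import numFieldNormedType.Exports.

Set Implicit Arguments.
Unset Strict Implicit.
Unset Printing Implicit Defensive.

Local Open Scope ring_scope.

Definition pt (R : realType) (x y : R) : 'I_2 -> R := tnth [tuple x; y].

(* A vector field (P, Q) on the plane stands for the system u' = P, v' = Q;
   'X_0 is the first coordinate and 'X_1 the second one. *)
Definition vfield (R : realType) : Type := {mpoly R[2]} * {mpoly R[2]}.

(* X k and Y k are the components of degree k; their values for k > n are
   never used. *)
Definition full_field (R : realType) (n : nat) (X Y : nat -> {mpoly R[2]}) :
    vfield R :=
  (\sum_(k < n.+1) X k, \sum_(k < n.+1) Y k).

Definition relatively_prime (R : realType) (p q : {mpoly R[2]}) : Prop :=
  forall d p1 q1 : {mpoly R[2]}, p = p1 * d -> q = q1 * d ->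
    exists c : R, d = c%:MP.

Definition system_of_degree (R : realType) (n : nat)
    (X Y : nat -> {mpoly R[2]}) : Prop :=
  [/\ forall k : nat, (k <= n)%N -> X k \is k.-homog /\ Y k \is k.-homog,
      ~ (X n = 0 /\ Y n = 0) &
      relatively_prime (full_field n X Y).1 (full_field n X Y).2].

Definition W (R : realType) (X Y : nat -> {mpoly R[2]}) (i : nat) :
    {mpoly R[2]} :=
  'X_(0 : 'I_2) * Y i - 'X_(1 : 'I_2) * X i.

Definition projectively_singular (R : realType) (n : nat)
    (X Y : nat -> {mpoly R[2]}) : Prop :=
  forall x y : R, (W X Y n).@[pt x y] = 0.

(* The substitution x = sx(u, v), y = sy(u, v) turns the system of F into
   u' = P(u, v), v' = Q(u, v) on the domain dom of the (u, v)-plane. *)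
Definition turns_into (R : realType) (dom : R -> R -> Prop)
    (sx sy : R -> R -> R) (F : vfield R) (P Q : R -> R -> R) : Prop :=
  forall (u v : R -> R) (t : R),
    dom (u t) (v t) -> derivable u t 1 -> derivable v t 1 ->
    let x := fun s => sx (u s) (v s) in
    let y := fun s => sy (u s) (v s) in
    (derive1 x t = F.1.@[pt (x t) (y t)] /\ derive1 y t = F.2.@[pt (x t) (y t)])
    <-> (derive1 u t = P (u t) (v t) /\ derive1 v t = Q (u t) (v t)).

Definition divisible_by_var (R : realType) (i : 'I_2) (p : {mpoly R[2]}) :
    Prop :=
  exists q : {mpoly R[2]}, p = q * 'X_i.

(* The coordinate of index i is the one that vanishes on the line at
   infinity. *)
Definition reduced (R : realType) (i : 'I_2) (sx sy : R -> R -> R)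
    (F G : vfield R) : Prop :=
  exists m : int,
    turns_into (fun u v => pt u v i <> 0) sx sy F
      (fun u v => pt u v i ^ (- m) * G.1.@[pt u v])
      (fun u v => pt u v i ^ (- m) * G.2.@[pt u v])
    /\ ~ (divisible_by_var i G.1 /\ divisible_by_var i G.2).

Definition first_reduced (R : realType) : vfield R -> vfield R -> Prop :=
  reduced 1 (fun xi theta => theta^-1) (fun xi theta => xi / theta).

Definition second_reduced (R : realType) : vfield R -> vfield R -> Prop :=
  reduced 0 (fun eta zeta => zeta / eta) (fun eta zeta => eta^-1).

(* The line a u + b v + c = 0 of the (u, v)-plane consists of trajectories:
   the field is tangent to it at each of its points. *)
Definition consists_of_trajectories (R : realType) (G : vfield R)
    (a b c : R) : Prop :=
  forall u v : R, a * u + b * v + c = 0 ->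
    a * G.1.@[pt u v] + b * G.2.@[pt u v] = 0.

(* The projective line a x + b y + c = 0, read in the charts (x, y),
   (xi, theta) = (y / x, 1 / x) and (eta, zeta) = (1 / y, x / y), where its
   equations are a x + b y + c = 0, a + b xi + c theta = 0 and
   a zeta + b + c eta = 0. The line at infinity is (a, b, c) = (0, 0, 1); it
   has no point in the chart (x, y). G1 and G2 are the first and second
   reduced systems of F. *)
Definition proj_consists_of_trajectories (R : realType) (F G1 G2 : vfield R)
    (a b c : R) : Prop :=
  [/\ consists_of_trajectories F a b c,
      consists_of_trajectories G1 b c a &
      consists_of_trajectories G2 c a b].

(* first_reduced and second_reduced are relations; reduced_unique,
   first_reduced_exists and second_reduced_exists show that a system of degree
   n has exactly one reduced system of each kind. *)

Section Reduced.
Variable R : realType.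
Implicit Types (p q : {mpoly R[2]}) (F G : vfield R) (i : 'I_2) (n : nat)
  (X Y : nat -> {mpoly R[2]}).

Lemma pt0 (x y : R) : pt x y 0 = x. Proof. by []. Qed.
Lemma pt1 (x y : R) : pt x y 1 = y. Proof. by []. Qed.

Lemma meval_pt p (x y : R) : p.@[pt x y] =
  \sum_(m <- msupp p) p@_m * (x ^+ m 0 * y ^+ m 1).
Proof.
rewrite mevalE; apply: eq_bigr => m _; congr (_ * _).
rewrite !big_ord_recl big_ord0 mulr1.
by congr (_ ^+ _ * _ ^+ m _); apply: val_inj.
Qed.

Lemma poly_fun0 (p : {poly R}) : (forall t, p.[t] = 0) -> p = 0.
Proof.
move=> p0; apply: (@roots_geq_poly_eq0 _ p [seq k%:R | k <- iota 0 (size p)]).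
- by apply/allP => x _; rewrite rootE p0.
- rewrite map_inj_uniq ?iota_uniq // => a b /eqP.
  by rewrite eqr_nat => /eqP.
- by rewrite size_map size_iota.
Qed.

Lemma mpoly_fun0 p : (forall x y, p.@[pt x y] = 0) -> p = 0.
Proof.
move=> p0; set B := msize p.
pose e (m : 'X_{1..2}) : nat := (m 0%R + B * m 1%R)%N.
have ltB (m : 'X_{1..2}) : m \in msupp p -> (m 0%R < B)%N.
  move=> /msize_mdeg_lt; apply: leq_ltn_trans.
  by rewrite mdegE (bigD1 (0 : 'I_2)) //= leq_addr.
pose k : {poly R} := \sum_(m <- msupp p) p@_m *: 'X^(e m).
have k0 : k = 0.
  apply: poly_fun0 => t; rewrite -(p0 t (t ^+ B)) meval_pt /k.
  rewrite horner_sum; apply: eq_bigr => m _.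
  by rewrite hornerZ hornerXn /e exprD exprM.
apply/mpolyP => m; rewrite mcoeff0.
have [mp|] := boolP (m \in msupp p); last exact: memN_msupp_eq0.
have := congr1 (fun r : {poly R} => r`_(e m)) k0.
rewrite coef0 /k coef_sum (bigD1_seq m) //= coefZ coefXn eqxx mulr1.
rewrite big_seq_cond big1 ?addr0 // => m' /andP[m'p m'm].
rewrite coefZ coefXn; case: eqP => [em|]; last by rewrite mulr0.
case/eqP: m'm; have := ltB _ mp; have := ltB _ m'p.
move: em; rewrite /e => em h1 h2.
have e1 : m' 1 = m 1 by nia.
have e0 : m' 0 = m 0 by rewrite e1 in em; lia.
apply/mnmP => j; have [->|->] // : j = 0 \/ j = 1.
by case: j => [[|[|]]] // h; [left|right]; apply: val_inj.
Qed.

Lemma mpoly_fun_eq i p q :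
  (forall x y, pt x y i <> 0 -> p.@[pt x y] = q.@[pt x y]) -> p = q.
Proof.
move=> pq; apply/eqP; rewrite -subr_eq0.
have : 'X_i * (p - q) = 0.
  apply: mpoly_fun0 => x y; rewrite mevalM mevalXU mevalB.
  have [->|/eqP h] := eqVneq (pt x y i) 0; first by rewrite mul0r.
  by rewrite pq // subrr mulr0.
move=> /eqP; rewrite mulf_eq0 => /orP[/eqP h|//].
have := congr1 (mcoeff U_(i)) h; rewrite mcoeffX eqxx mcoeff0.
by move=> /eqP; rewrite oner_eq0.
Qed.

Lemma curve_with_velocity (a b x y : R) : exists u v : R -> R,
  [/\ u 0 = x, v 0 = y, derivable u 0 1 /\ derivable v 0 1,
      derive1 u 0 = a & derive1 v 0 = b].
Proof.
have H c z : is_derive (0 : R) (1 : R) (fun s : R => c * s + z) c.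
  have -> : (fun s : R => c * s + z) = cst c * (id : R -> R) + cst z by [].
  by apply: is_derive_eq; rewrite addr0 scaler0 addr0 /GRing.scale /= mulr1.
exists (fun s => a * s + x), (fun s => b * s + y).
have [? ?] := (H a x, H b y).
by split; rewrite ?mulr0 ?add0r // ?derive1E ?derive_val.
Qed.

Lemma reduced_unique i sx sy F G G' :
  reduced i sx sy F G -> reduced i sx sy F G' -> G = G'.
Proof.
have key G1 G2 m k :
  (forall x y, pt x y i <> 0 ->
    pt x y i ^ (- m) * G1.1.@[pt x y] =
    pt x y i ^ (- (m + k%:Z)) * G2.1.@[pt x y] /\
    pt x y i ^ (- m) * G1.2.@[pt x y] =
    pt x y i ^ (- (m + k%:Z)) * G2.2.@[pt x y]) ->
  ~ (divisible_by_var i G2.1 /\ divisible_by_var i G2.2) -> G1 = G2.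
  move=> H ndiv.
  have E p q : (forall x y, pt x y i <> 0 ->
      pt x y i ^ (- m) * p.@[pt x y] =
      pt x y i ^ (- (m + k%:Z)) * q.@[pt x y]) -> q = p * 'X_i ^+ k.
    move=> h; apply: (@mpoly_fun_eq i) => x y nz.
    have /eqP nz' := nz.
    apply: (@mulfI _ (pt x y i ^ (- (m + k%:Z)))).
      by rewrite expfz_neq0.
    rewrite -h // mevalM rmorphXn /= mevalXU mulrCA mulrC; congr (_ * _).
    by rewrite -[X in _ * X]/(_ ^ k%:Z) -expfzDr // opprD subrK.
  have e1 := E G1.1 G2.1 (fun x y nz => (H x y nz).1).
  have e2 := E G1.2 G2.2 (fun x y nz => (H x y nz).2).
  case: k H E e1 e2 => [|k] _ _ e1 e2.
    by case: G1 G2 e1 e2 {ndiv} => [? ?] [? ?] /= -> ->; rewrite !mulr1.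
  case: ndiv; split; eexists.
    by rewrite e1 exprSr mulrA.
  by rewrite e2 exprSr mulrA.
move=> [m [T nd]] [m' [T' nd']].
have H x y : pt x y i <> 0 ->
    pt x y i ^ (- m) * G.1.@[pt x y] = pt x y i ^ (- m') * G'.1.@[pt x y] /\
    pt x y i ^ (- m) * G.2.@[pt x y] = pt x y i ^ (- m') * G'.2.@[pt x y].
  move=> nz.
  have [u [v [u0 v0 [du dv] u1 v1]]] :=
    curve_with_velocity (pt x y i ^ (- m) * G.1.@[pt x y])
     (pt x y i ^ (- m) * G.2.@[pt x y]) x y.
  have nz' : pt (u 0) (v 0) i <> 0 by rewrite u0 v0.
  have := T' u v 0 nz' du dv; have := T u v 0 nz' du dv.
  by rewrite /= u0 v0 u1 v1 => T1 <-; apply/T1.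
have [le|/ltW le] := leP m m'.
  apply: (key G G' m `|m' - m|%N) => //.
  by have -> : m + `|m' - m|%N = m' by lia.
apply/esym/(key G' G m' `|m - m'|%N) => //.
have -> : m' + `|m - m'|%N = m by lia.
by move=> x y /H[-> ->].
Qed.

Lemma reduced_exists i sx sy F G (m : int) :
  turns_into (fun u v => pt u v i <> 0) sx sy F
    (fun u v => pt u v i ^ (- m) * G.1.@[pt u v])
    (fun u v => pt u v i ^ (- m) * G.2.@[pt u v]) ->
  ~ (G.1 = 0 /\ G.2 = 0) -> exists G', reduced i sx sy F G'.
Proof.
move: {2}(msize G.1 + msize G.2)%N (leqnn (msize G.1 + msize G.2)%N) => N.
elim: N G m => [|N IH] G m.
  rewrite leqn0 addn_eq0 => /andP[/eqP a /eqP b] _ []; split; apply/eqP.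
    by rewrite -msize_poly_eq0 a.
  by rewrite -msize_poly_eq0 b.
move=> leN T nz.
have [[[p1 e1] [p2 e2]]|nd] :=
  pselect (divisible_by_var i G.1 /\ divisible_by_var i G.2); last first.
  by exists G, m.
have nX : 'X_i != 0 :> {mpoly R[2]}.
  by rewrite -msize_poly_eq0 msizeX.
have sz p : (msize p <= msize (p * 'X_i))%N /\
    (p != 0%R -> msize p < msize (p * 'X_i))%N.
  have [->|h] := eqVneq p 0%R; first by rewrite mul0r msize0.
  by rewrite msizeM // msizeX mdeg1 addn2 /=; split.
apply: (IH (p1, p2) (m - 1)) => /=; last first.
- by move=> [a b]; apply: nz; rewrite e1 e2 a b !mul0r.
- move=> u v t d du dv x y; rewrite /x /y.
  have := T u v t d du dv; rewrite /= e1 e2 => ->.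
  have /eqP d' := d.
  have E p : pt (u t) (v t) i ^ (- m) * (p * 'X_i).@[pt (u t) (v t)] =
      pt (u t) (v t) i ^ (- (m - 1)) * p.@[pt (u t) (v t)].
    rewrite mevalM mevalXU mulrCA mulrC; congr (_ * _).
    by rewrite opprB addrC expfzDr // expr1z.
  by rewrite !E.
- rewrite -ltnS; apply: leq_trans leN.
  have [[a1 b1] [a2 b2]] := (sz p1, sz p2); rewrite e1 e2.
  have [p10|h] := eqVneq p1 0%R.
    have [p20|h'] := eqVneq p2 0%R.
      by case: nz; rewrite e1 e2 p10 p20 !mul0r.
    by rewrite -addnS leq_add // b2.
  by rewrite -addSn leq_add // b1.
Qed.

Lemma homog_scale k p (c x y : R) : p \is k.-homog ->
  p.@[pt (c * x) (c * y)] = c ^+ k * p.@[pt x y].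
Proof.
move=> hp; rewrite !meval_pt mulr_sumr !big_seq; apply: eq_bigr => m mp.
have /= <- : mdeg m = k by move: hp => /dhomogP; apply.
rewrite mdegE !big_ord_recl big_ord0 addn0 !exprMn exprD.
have -> : lift ord0 ord0 = 1 :> 'I_2 by apply: val_inj.
by have -> : ord0 = 0 :> 'I_2 by []; ring.
Qed.

Lemma full_field_neq0 n X Y : system_of_degree n X Y ->
  ~ ((full_field n X Y).1 = 0 /\ (full_field n X Y).2 = 0).
Proof.
move=> [_ _ cop] [X0 Y0].
have [||c hc] := cop 'X_0 0 0; rewrite ?mul0r //.
have := congr1 (mcoeff U_(0 : 'I_2)) hc.
rewrite mcoeffX eqxx mcoeffC mnm1_eq0 mulr0 => /eqP.
by rewrite oner_eq0.
Qed.

(* theta ^ n Z(1 / theta, xi / theta) for a = 1, b = 'X_0 and i = 1, and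
   eta ^ n Z(zeta / eta, 1 / eta) for a = 'X_1, b = 1 and i = 0, where Z stands
   for the sum of its components of degree at most n. *)
Definition chart_numerator (n : nat) (a b : {mpoly R[2]}) i
    (Z : nat -> {mpoly R[2]}) : {mpoly R[2]} :=
  \sum_(k < n.+1) 'X_i ^+ (n - k) * (Z k \mPo [tuple a; b]).

Lemma meval_chart_numerator n a b i (Z : nat -> {mpoly R[2]}) (u v : R) :
  (forall k, (k <= n)%N -> Z k \is k.-homog) -> pt u v i != 0 ->
  (chart_numerator n a b i Z).@[pt u v] =
  pt u v i ^+ n *
    (\sum_(k < n.+1) Z k)
      .@[pt (a.@[pt u v] / pt u v i) (b.@[pt u v] / pt u v i)].
Proof.
move=> hZ nz; rewrite /chart_numerator !rmorph_sum /= mulr_sumr.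
apply: eq_bigr => k _.
have hk : (k <= n)%N by rewrite -ltnS.
rewrite mevalM rmorphXn /= mevalXU comp_mpoly_meval.
rewrite -[in RHS](mulrC (pt u v i)^-1) -[in RHS](mulrC (pt u v i)^-1).
rewrite (homog_scale _ _ _ (hZ k hk)) mulrA; congr (_ * _).
  by rewrite exprVn exprB ?unitfE.
apply: meval_eq => j.
by case: j => [[|[|]]] // h; rewrite !(tnth_nth 0) /= (tnth_nth 0).
Qed.

Lemma derive1_inv (v : R -> R) t : v t <> 0 -> derivable v t 1 ->
  derive1 (fun s => (v s)^-1) t = - derive1 v t / v t ^+ 2.
Proof.
move=> /eqP nz dv.
by rewrite !derive1E deriveV // /GRing.scale /= mulrC mulrN mulNr.
Qed.

Lemma derive1_div (u v : R -> R) t : v t <> 0 -> derivable u t 1 ->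
  derivable v t 1 -> derive1 (fun s => u s / v s) t =
  derive1 u t / v t - u t * derive1 v t / v t ^+ 2.
Proof.
move=> /eqP nz du dv.
rewrite !derive1E (deriveM du (derivableV nz dv)) deriveV // /GRing.scale /=.
by field.
Qed.

Lemma chart_velocities (u v u' v' A B : R) : v <> 0 ->
  ((- v' / v ^+ 2 = A /\ u' / v - u * v' / v ^+ 2 = B) <->
   (u' = v * (B - u * A) /\ v' = - v ^+ 2 * A)).
Proof.
move=> /eqP nz; split=> [[<- <-]|[-> ->]]; split; by field.
Qed.

Lemma chart_rescaling (u v A B : R) k : v <> 0 ->
  v * (B - u * A) = v / v ^+ k * (v ^+ k * B - u * (v ^+ k * A)) /\
  - v ^+ 2 * A = v / v ^+ k * - (v * (v ^+ k * A)).
Proof. by move=> /eqP nz; split; field; rewrite ?nz ?expf_neq0. Qed.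

Lemma first_reduced_exists n X Y : system_of_degree n X Y ->
  exists G, first_reduced (full_field n X Y) G.
Proof.
move=> XY; case: (XY) => hom _ _.
pose Xh := chart_numerator n 1 'X_0 1 X.
pose Yh := chart_numerator n 1 'X_0 1 Y.
have hatE Z u v : (forall k, (k <= n)%N -> Z k \is k.-homog) -> v <> 0 ->
    (chart_numerator n 1 'X_0 1 Z).@[pt u v] =
    v ^+ n * (\sum_(k < n.+1) Z k).@[pt v^-1 (u / v)].
  by move=> hZ /eqP nz; rewrite meval_chart_numerator // meval1 mevalXU div1r.
have homX k : (k <= n)%N -> X k \is k.-homog by move=> /hom[].
have homY k : (k <= n)%N -> Y k \is k.-homog by move=> /hom[].
apply: (@reduced_exists 1 _ _ _ (Yh - 'X_0 * Xh, - ('X_1 * Xh)) (n%:Z - 1)).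
  move=> u v t; rewrite pt1 => nz du dv x y.
  have /eqP nz' := nz.
  rewrite /x /y derive1_inv // derive1_div // chart_velocities //=.
  rewrite mevalN mevalB !mevalM !mevalXU /Xh /Yh !hatE // pt0 pt1.
  rewrite opprB expfzDr // expr1z -exprnN.
  set A := meval _ _; set B := meval _ _.
  by have [-> ->] := chart_rescaling (u t) B A n nz.
case=> /= Y0 /eqP; rewrite oppr_eq0 mulf_eq0 -msize_poly_eq0 msizeX /= => /eqP.
move=> X0; move: Y0; rewrite X0 mulr0 subr0 => Y0.
have hat0 Z : (forall k, (k <= n)%N -> Z k \is k.-homog) ->
    chart_numerator n 1 'X_0 1 Z = 0 -> \sum_(k < n.+1) Z k = 0.
  move=> hZ Z0; apply: (@mpoly_fun_eq 0) => x y; rewrite pt0 meval0 => /eqP nz.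
  have := hatE Z (y / x) x^-1 hZ; rewrite Z0 meval0 => H.
  have /eqP nz' : x^-1 != 0 by rewrite invr_eq0.
  have /esym/eqP := H nz'.
  rewrite mulf_eq0 expf_eq0 invr_eq0 (negbTE nz) andbF /= !invrK => /eqP.
  by rewrite divfK.
by apply: (full_field_neq0 XY); rewrite /= !hat0.
Qed.

Lemma second_reduced_exists n X Y : system_of_degree n X Y ->
  exists G, second_reduced (full_field n X Y) G.
Proof.
move=> XY; case: (XY) => hom _ _.
pose Xh := chart_numerator n 'X_1 1 0 X.
pose Yh := chart_numerator n 'X_1 1 0 Y.
have hatE Z u v : (forall k, (k <= n)%N -> Z k \is k.-homog) -> u <> 0 ->
    (chart_numerator n 'X_1 1 0 Z).@[pt u v] =
    u ^+ n * (\sum_(k < n.+1) Z k).@[pt (v / u) u^-1].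
  by move=> hZ /eqP nz; rewrite meval_chart_numerator // meval1 mevalXU div1r.
have homX k : (k <= n)%N -> X k \is k.-homog by move=> /hom[].
have homY k : (k <= n)%N -> Y k \is k.-homog by move=> /hom[].
apply: (@reduced_exists 0 _ _ _ (- ('X_0 * Yh), Xh - 'X_1 * Yh) (n%:Z - 1)).
  move=> u v t; rewrite pt0 => nz du dv x y.
  have /eqP nz' := nz.
  rewrite /x /y derive1_inv // derive1_div // and_comm chart_velocities //=.
  rewrite mevalN mevalB !mevalM !mevalXU /Xh /Yh !hatE // pt0 pt1.
  rewrite opprB expfzDr // expr1z -exprnN.
  set A := meval _ _; set B := meval _ _.
  by have [-> ->] := chart_rescaling (v t) B A n nz; rewrite and_comm.
case=> /= /eqP; rewrite oppr_eq0 mulf_eq0 -msize_poly_eq0 msizeX /= => /eqP.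
move=> Y0; rewrite Y0 mulr0 subr0 => X0.
have hat0 Z : (forall k, (k <= n)%N -> Z k \is k.-homog) ->
    chart_numerator n 'X_1 1 0 Z = 0 -> \sum_(k < n.+1) Z k = 0.
  move=> hZ Z0; apply: (@mpoly_fun_eq 1) => x y; rewrite pt1 meval0 => /eqP nz.
  have := hatE Z y^-1 (x / y) hZ; rewrite Z0 meval0 => H.
  have /eqP nz' : y^-1 != 0 by rewrite invr_eq0.
  have /esym/eqP := H nz'.
  rewrite mulf_eq0 expf_eq0 invr_eq0 (negbTE nz) andbF /= !invrK => /eqP.
  by rewrite divfK.
by apply: (full_field_neq0 XY); rewrite /= !hat0.
Qed.

End Reduced.

(* Main.v *)
Require Import Defs.
From mathcomp Require Import all_boot all_order all_algebra.
From mathcomp Require Import mpoly.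
From mathcomp Require Import boolp reals.
Import Order.TTheory GRing.Theory Num.Theory.
Local Open Scope ring_scope.

(** Write x = 1 / theta, y = xi / theta and let Xh, Yh be theta ^ n X(x, y) and
theta ^ n Y(x, y), which are polynomials in xi and theta. The chain rule gives
  xi' = theta ^ (1 - n) (Yh - xi Xh),  theta' = - theta ^ (1 - n) theta Xh,
and Yh - xi Xh is the sum of the theta ^ (n - k) W_k(1, xi) for k <= n, hence
of the form W_n(1, xi) + theta T ([first_chart_field], [numerator_W],
[numerator_split]). Everything depends on whether the common factor theta can
be extracted.

If W_n is not identically zero, neither is W_n(1, xi), by homogeneity; then
(Yh - xi Xh, - theta Xh) is already the reduced system
([first_reduced_nonsingular]) and its second component vanishes on theta = 0.
If W_n = 0, then theta divides both components and the quotient is (T, - Xh),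
which is the system displayed in the equivalence. On theta = 0 its second
component is - X_n(1, xi), and this is not identically zero: otherwise X_n = 0,
and then x Y_n = y X_n forces Y_n = 0, against the definition of the degree
([singular_X_neq0]). So no further factor can be extracted
([first_reduced_singular]) and theta = 0 is not invariant.

The chart (eta, zeta) = (1 / y, x / y) is handled in the same way with the
roles of X and Y exchanged. Since the reduced systems are unique, all the
properties hold in the singular case and all of them fail in the nonsingular
one. *)

(** * Polynomials, divisibility and homogeneity *)

Lemma divisible_by_var_eq0 {R : realType} {i : 'I_2} {p : {mpoly R[2]}}
    {u v : R} :
  divisible_by_var i p -> pt u v i = 0 -> p.@[pt u v] = 0.
Proof. by move=> [q ->] uv0; rewrite mevalM mevalXU uv0 mulr0. Qed.

Lemma homog_eq0_x1 {R : realType} {k : nat} {p : {mpoly R[2]}} :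
  p \is k.-homog -> (forall y, p.@[pt 1 y] = 0) -> p = 0.
Proof.
move=> hp p0; apply: (@mpoly_fun_eq _ 0) => x y /eqP; rewrite pt0 meval0 => nz.
have -> : pt x y = pt (x * 1) (x * (y / x)) by rewrite mulr1 mulrC divfK.
by rewrite (homog_scale _ _ _ hp) p0 mulr0.
Qed.

Lemma homog_eq0_y1 {R : realType} {k : nat} {p : {mpoly R[2]}} :
  p \is k.-homog -> (forall x, p.@[pt x 1] = 0) -> p = 0.
Proof.
move=> hp p0; apply: (@mpoly_fun_eq _ 1) => x y /eqP; rewrite pt1 meval0 => nz.
have -> : pt x y = pt (y * (x / y)) (y * 1) by rewrite mulr1 mulrC divfK.
by rewrite (homog_scale _ _ _ hp) p0 mulr0.
Qed.

(** A common factor 'X_i of both components lowers the exponent m by one. *)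
Lemma turns_into_divided {R : realType} {i : 'I_2} {sx sy : R -> R -> R}
    {F : vfield R} {P Q : {mpoly R[2]}} {m : int} :
  turns_into (fun u v => pt u v i <> 0) sx sy F
    (fun u v => pt u v i ^ (- m) * ('X_i * P).@[pt u v])
    (fun u v => pt u v i ^ (- m) * ('X_i * Q).@[pt u v]) ->
  turns_into (fun u v => pt u v i <> 0) sx sy F
    (fun u v => pt u v i ^ (- (m - 1)) * P.@[pt u v])
    (fun u v => pt u v i ^ (- (m - 1)) * Q.@[pt u v]).
Proof.
move=> T u v t uv_neq0 du dv x y; rewrite /x /y (T u v t uv_neq0 du dv) /=.
move: uv_neq0 => /eqP uv_neq0.
have divE p : pt (u t) (v t) i ^ (- m) * ('X_i * p).@[pt (u t) (v t)] =
    pt (u t) (v t) i ^ (- (m - 1)) * p.@[pt (u t) (v t)].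
  by rewrite mevalM mevalXU mulrA opprB addrC expfzDr // expr1z mulrC.
by rewrite !divE.
Qed.

(** * Numerators of a field in a chart *)

Section ChartNumerators.
Context {R : realType}.
Implicit Types (n : nat) (a b : {mpoly R[2]}) (i : 'I_2)
  (X Y Z : nat -> {mpoly R[2]}).

(** The quotient by 'X_i of the terms of index k < n in
[chart_numerator n a b i Z]. *)
Definition chart_tail n a b i Z : {mpoly R[2]} :=
  \sum_(k < n) 'X_i ^+ (n - k - 1) * (Z k \mPo [tuple a; b]).

Lemma meval_comp_pt (p a b : {mpoly R[2]}) (u v : R) :
  (p \mPo [tuple a; b]).@[pt u v] = p.@[pt a.@[pt u v] b.@[pt u v]].
Proof.
rewrite comp_mpoly_meval; apply: meval_eq => j.
by case: j => [[|[|]]] // h; rewrite !(tnth_nth 0) /= (tnth_nth 0).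
Qed.

Lemma meval_numerator n a b i Z (u v : R) :
  (chart_numerator n a b i Z).@[pt u v] =
  \sum_(k < n.+1) pt u v i ^+ (n - k) * (Z k).@[pt a.@[pt u v] b.@[pt u v]].
Proof.
rewrite /chart_numerator rmorph_sum; apply: eq_bigr => k _ /=.
by rewrite mevalM rmorphXn /= mevalXU meval_comp_pt.
Qed.

Lemma meval_tail n a b i Z (u v : R) :
  (chart_tail n a b i Z).@[pt u v] =
  \sum_(k < n) pt u v i ^+ (n - k - 1) * (Z k).@[pt a.@[pt u v] b.@[pt u v]].
Proof.
rewrite /chart_tail rmorph_sum; apply: eq_bigr => k _ /=.
by rewrite mevalM rmorphXn /= mevalXU meval_comp_pt.
Qed.

Lemma numerator_split n a b i Z :
  chart_numerator n a b i Z =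
  (Z n \mPo [tuple a; b]) + 'X_i * chart_tail n a b i Z.
Proof.
rewrite /chart_numerator big_ord_recr /= subnn expr0 mul1r addrC.
congr (_ + _); rewrite mulr_sumr; apply: eq_bigr => k _.
by rewrite mulrA -exprS subn1 prednK // subn_gt0.
Qed.

(** On the line at infinity only the component of highest degree survives. *)
Lemma meval_numerator_line n a b i Z (u v : R) : pt u v i = 0 ->
  (chart_numerator n a b i Z).@[pt u v] =
  (Z n).@[pt a.@[pt u v] b.@[pt u v]].
Proof.
move=> uv0; rewrite numerator_split mevalD meval_comp_pt mevalM mevalXU uv0.
by rewrite mul0r addr0.
Qed.

(** For (a, b) = (1, 'X_0) and (a, b) = ('X_1, 1) the right-hand side is, up to
sign, the numerator of the velocity of the coordinate along the line at
infinity. *)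
Lemma numerator_W n a b i X Y :
  chart_numerator n a b i (W X Y) =
  a * chart_numerator n a b i Y - b * chart_numerator n a b i X.
Proof.
rewrite /chart_numerator !mulr_sumr -sumrB; apply: eq_bigr => k _.
rewrite /W rmorphB !rmorphM /= !comp_mpolyXU /=.
by rewrite mulrBr !mulrA ![_ * 'X_i ^+ _]mulrC.
Qed.

End ChartNumerators.

(** * The reduced systems in the singular and nonsingular cases *)

Section Singularity.
Context {R : realType} {n : nat} {X Y : nat -> {mpoly R[2]}}
  (hD : system_of_degree n X Y).

Lemma homogX k : (k <= n)%N -> X k \is k.-homog.
Proof. by case: hD => hom _ _ /hom[]. Qed.

Lemma homogY k : (k <= n)%N -> Y k \is k.-homog.
Proof. by case: hD => hom _ _ /hom[]. Qed.

Lemma homogW : W X Y n \is n.+1.-homog.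
Proof.
have homX1 (i : 'I_2) : ('X_i : {mpoly R[2]}) \is 1.-homog.
  by rewrite dhomogX /= mdeg1.
by rewrite rpredB ?(dhomogM (homX1 _)) ?homogX ?homogY.
Qed.

Lemma singular_x1 :
  (forall y, (W X Y n).@[pt 1 y] = 0) -> projectively_singular n X Y.
Proof. by move=> W0 x y; rewrite (homog_eq0_x1 homogW W0) meval0. Qed.

Lemma singular_y1 :
  (forall x, (W X Y n).@[pt x 1] = 0) -> projectively_singular n X Y.
Proof. by move=> W0 x y; rewrite (homog_eq0_y1 homogW W0) meval0. Qed.

Lemma meval_W k (x y : R) :
  (W X Y k).@[pt x y] = x * (Y k).@[pt x y] - y * (X k).@[pt x y].
Proof. by rewrite /W mevalB !mevalM !mevalXU pt0 pt1. Qed.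

(** If X_n(1, y) vanishes identically then X_n = 0, and W_n = 0 at (1, y) reads
Y_n(1, y) = y X_n(1, y) = 0, so that Y_n = 0 too. *)
Lemma singular_X_neq0 :
  projectively_singular n X Y -> ~ forall y, (X n).@[pt 1 y] = 0.
Proof.
move=> sing X0; case: hD => _ + _; apply; split.
  exact: (homog_eq0_x1 (homogX _ (leqnn n))).
apply: (homog_eq0_x1 (homogY _ (leqnn n))) => y.
by have := sing 1 y; rewrite meval_W X0 mulr0 subr0 mul1r.
Qed.

Lemma singular_Y_neq0 :
  projectively_singular n X Y -> ~ forall x, (Y n).@[pt x 1] = 0.
Proof.
move=> sing Y0; case: hD => _ + _; apply; split; last first.
  exact: (homog_eq0_y1 (homogY _ (leqnn n))).
apply: (homog_eq0_y1 (homogX _ (leqnn n))) => x.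
have /eqP := sing x 1.
by rewrite meval_W Y0 mulr0 sub0r mul1r oppr_eq0 => /eqP.
Qed.

Lemma singular_W_eq0 : projectively_singular n X Y -> W X Y n = 0.
Proof. by move=> sing; apply: mpoly_fun0 => x y; apply: sing. Qed.

Lemma first_chart_field :
  turns_into (fun u v => pt u v 1 <> 0)
    (fun xi theta => theta^-1) (fun xi theta => xi / theta)
    (full_field n X Y)
    (fun u v => pt u v 1 ^ (- (n%:Z - 1)) *
       (chart_numerator n 1 'X_0 1 (W X Y)).@[pt u v])
    (fun u v => pt u v 1 ^ (- (n%:Z - 1)) *
       ('X_1 * - chart_numerator n 1 'X_0 1 X).@[pt u v]).
Proof.
move=> u v t nz du dv x y; rewrite /x /y {x y}.
rewrite pt1 in nz *; have /eqP nz' := nz.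
rewrite derive1_inv // derive1_div // chart_velocities //=.
rewrite numerator_W mul1r mulrN mevalN mevalB !mevalM !mevalXU.
rewrite !meval_chart_numerator //; [|exact: homogX|exact: homogY].
rewrite meval1 mevalXU pt0 pt1 div1r opprB expfzDr // expr1z -exprnN.
set A := meval _ (\sum_(k < _) X _); set B := meval _ _.
by have [-> ->] := chart_rescaling (u t) A B n nz.
Qed.

Lemma second_chart_field :
  turns_into (fun u v => pt u v 0 <> 0)
    (fun eta zeta => zeta / eta) (fun eta zeta => eta^-1)
    (full_field n X Y)
    (fun u v => pt u v 0 ^ (- (n%:Z - 1)) *
       ('X_0 * - chart_numerator n 'X_1 1 0 Y).@[pt u v])
    (fun u v => pt u v 0 ^ (- (n%:Z - 1)) *
       (- chart_numerator n 'X_1 1 0 (W X Y)).@[pt u v]).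
Proof.
move=> u v t nz du dv x y; rewrite /x /y {x y}.
rewrite pt0 in nz *; have /eqP nz' := nz.
rewrite derive1_inv // derive1_div // and_comm chart_velocities //=.
rewrite numerator_W mul1r mulrN opprB !mevalN mevalB !mevalM !mevalXU.
rewrite !meval_chart_numerator //; [|exact: homogY|exact: homogX].
rewrite meval1 mevalXU pt0 pt1 div1r opprB expfzDr // expr1z -exprnN.
set A := meval _ (\sum_(k < _) Y _); set B := meval _ _.
by have [-> ->] := chart_rescaling (v t) A B n nz; rewrite and_comm.
Qed.

(** On theta = 0 the first component is W_n(1, xi), so it is not divisible by
theta. *)
Lemma first_reduced_nonsingular : ~ projectively_singular n X Y ->
  first_reduced (full_field n X Y)
    (chart_numerator n 1 'X_0 1 (W X Y),
     'X_1 * - chart_numerator n 1 'X_0 1 X).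
Proof.
move=> nsing; exists (n%:Z - 1); split; first exact: first_chart_field.
move=> [div_W _]; apply: nsing; apply: singular_x1 => y.
have := divisible_by_var_eq0 div_W (pt1 y 0).
by rewrite meval_numerator_line // meval1 mevalXU.
Qed.

(** On eta = 0 the second component is - W_n(zeta, 1). *)
Lemma second_reduced_nonsingular : ~ projectively_singular n X Y ->
  second_reduced (full_field n X Y)
    ('X_0 * - chart_numerator n 'X_1 1 0 Y,
     - chart_numerator n 'X_1 1 0 (W X Y)).
Proof.
move=> nsing; exists (n%:Z - 1); split; first exact: second_chart_field.
move=> [_ div_W]; apply: nsing; apply: singular_y1 => x.
have /eqP := divisible_by_var_eq0 div_W (pt0 0 x).
by rewrite mevalN oppr_eq0 meval_numerator_line // meval1 mevalXU => /eqP.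
Qed.

(** The factor theta is common to both components of [first_chart_field]; after
its removal the second one is - X_n(1, xi) on theta = 0. *)
Lemma first_reduced_singular : projectively_singular n X Y ->
  first_reduced (full_field n X Y)
    (chart_tail n 1 'X_0 1 (W X Y), - chart_numerator n 1 'X_0 1 X).
Proof.
move=> sing; exists (n%:Z - 1 - 1); split.
  apply: turns_into_divided; have := first_chart_field.
  rewrite (numerator_split _ _ _ _ (W X Y)) singular_W_eq0 //.
  by rewrite comp_mpoly0 add0r.
move=> [_ div_X]; apply: (singular_X_neq0 sing) => y.
have /eqP := divisible_by_var_eq0 div_X (pt1 y 0).
by rewrite mevalN oppr_eq0 meval_numerator_line // meval1 mevalXU => /eqP.
Qed.

(** After removal of the common factor eta the first component is - Y_n(zeta, 1)
on eta = 0. *)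
Lemma second_reduced_singular : projectively_singular n X Y ->
  second_reduced (full_field n X Y)
    (- chart_numerator n 'X_1 1 0 Y, - chart_tail n 'X_1 1 0 (W X Y)).
Proof.
move=> sing; exists (n%:Z - 1 - 1); split.
  apply: turns_into_divided; have := second_chart_field.
  rewrite (numerator_split _ _ _ _ (W X Y)) singular_W_eq0 //.
  by rewrite comp_mpoly0 add0r -mulrN.
move=> [div_Y _]; apply: (singular_Y_neq0 sing) => x.
have /eqP := divisible_by_var_eq0 div_Y (pt0 0 x).
by rewrite mevalN oppr_eq0 meval_numerator_line // meval1 mevalXU => /eqP.
Qed.

End Singularity.

(** * The equivalence *)

Lemma theta_line_trajectories {R : realType} (P Q : {mpoly R[2]}) :
  consists_of_trajectories (P, Q) 0 1 0 <-> forall xi, Q.@[pt xi 0] = 0.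
Proof.
split=> [H xi|H u v]; last by rewrite !mul0r !mul1r add0r addr0 add0r => ->.
by have := H xi 0; rewrite !mul0r !mul1r !add0r; apply.
Qed.

Lemma eta_line_trajectories {R : realType} (P Q : {mpoly R[2]}) :
  consists_of_trajectories (P, Q) 1 0 0 <-> forall zeta, P.@[pt 0 zeta] = 0.
Proof.
split=> [H zeta|H u v]; last by rewrite !mul0r !mul1r !addr0 => ->.
by have := H 0 zeta; rewrite !mul0r !mul1r !addr0; apply.
Qed.

Theorem mainTheorem13 (R : realType) (n : nat) (X Y : nat -> {mpoly R[2]})
    (Xi Theta H Z : {mpoly R[2]})
    (hD : system_of_degree n X Y)
    (h1 : first_reduced (full_field n X Y) (Xi, Theta))
    (h2 : second_reduced (full_field n X Y) (H, Z)) :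
  [<->
    (* (1) *)
    ~ proj_consists_of_trajectories (full_field n X Y) (Xi, Theta) (H, Z) 0 0 1;
    (* (2) *)
    forall x y : R, (W X Y n).@[pt x y] = 0;
    (* (3) *)
    projectively_singular n X Y;
    (* (4) *)
    forall xi theta : R,
      Xi.@[pt xi theta]
        = \sum_(j < n) theta ^+ (n - j - 1) * (W X Y j).@[pt 1 xi] /\
      Theta.@[pt xi theta]
        = - \sum_(i < n.+1) theta ^+ (n - i) * (X i).@[pt 1 xi];
    (* (5) *)
    ~ consists_of_trajectories (Xi, Theta) 0 1 0;
    (* (6) *)
    forall eta zeta : R,
      H.@[pt eta zeta]
        = - \sum_(i < n.+1) eta ^+ (n - i) * (Y i).@[pt zeta 1] /\
      Z.@[pt eta zeta]
        = - \sum_(j < n) eta ^+ (n - j - 1) * (W X Y j).@[pt zeta 1];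
    (* (7) *)
    ~ consists_of_trajectories (H, Z) 1 0 0].
Proof.
have [sing|nsing] := EM (projectively_singular n X Y).
  have [XiE ThetaE] := reduced_unique h1 (first_reduced_singular hD sing).
  have [HE ZE] := reduced_unique h2 (second_reduced_singular hD sing).
  have theta_line : ~ consists_of_trajectories (Xi, Theta) 0 1 0.
    move=> /theta_line_trajectories Theta0.
    apply: (singular_X_neq0 hD sing) => y.
    have /eqP := Theta0 y; rewrite ThetaE mevalN oppr_eq0.
    by rewrite meval_numerator_line // meval1 mevalXU => /eqP.
  have eta_line : ~ consists_of_trajectories (H, Z) 1 0 0.
    move=> /eta_line_trajectories H0.
    apply: (singular_Y_neq0 hD sing) => x.
    have /eqP := H0 x; rewrite HE mevalN oppr_eq0.
    by rewrite meval_numerator_line // meval1 mevalXU => /eqP.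
  tfae=> // _.
  - move=> xi theta; rewrite XiE ThetaE mevalN meval_tail meval_numerator.
    by rewrite meval1 mevalXU.
  - move=> eta zeta; rewrite HE ZE !mevalN meval_tail meval_numerator.
    by rewrite meval1 mevalXU.
  - by case.
have [XiE ThetaE] := reduced_unique h1 (first_reduced_nonsingular hD nsing).
have [HE ZE] := reduced_unique h2 (second_reduced_nonsingular hD nsing).
have theta_line : consists_of_trajectories (Xi, Theta) 0 1 0.
  by apply/theta_line_trajectories => xi; rewrite ThetaE mevalM mevalXU mul0r.
have eta_line : consists_of_trajectories (H, Z) 1 0 0.
  by apply/eta_line_trajectories => zeta; rewrite HE mevalM mevalXU mul0r.
tfae=> //.
(* The line (0, 0, 1) has no point in the chart (x, y). *)
- case; split=> // u v /eqP; by rewrite !mul0r !add0r oner_eq0.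
(* The actual first component is W_n(1, xi) + theta T and the displayed one is
   T: they agree at theta = 1 only if W_n(1, xi) = 0. *)
- move=> E; case: nsing; apply: (singular_x1 hD) => y.
  have [+ _] := E y 1.
  rewrite XiE numerator_split mevalD mevalM mevalXU meval_tail meval_comp_pt.
  by rewrite meval1 mevalXU pt0 pt1 mul1r => /(canRL (addrK _)); rewrite subrr.
(* The same comparison at eta = 1 for the second component. *)
- move=> E; case: nsing; apply: (singular_y1 hD) => x.
  have [_] := E 1 x.
  rewrite ZE numerator_split mevalN mevalD mevalM mevalXU meval_tail.
  rewrite meval_comp_pt meval1 mevalXU pt0 pt1 mul1r => /oppr_inj.
  by move=> /(canRL (addrK _)); rewrite subrr.
Qed.
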